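(* The polynomials that are both fundamental particles and Young fundamental particles are precisely the $\hat{\mathfrak L}_a$ such that $a$ has no zero part adjacent to a part of size at least $2$.
   Context: Weak compositions have length $n$. The fundamental particle $\mathfrak L_a$ is the generating function of fillings of the diagram of $a$ (row $i$ has $a_i$ left-justified boxes) such that rows weakly decrease left to right, the first entry of each row $i$ equals $i$, and whenever $i<j$ every entry of row $i$ is strictly smaller than every entry of row $j$. The Young fundamental particle is $\hat{\mathfrak L}_a(x_1,\ldots,x_n)=\mathfrak L_{\mathrm{rev}(a)}(x_n,\ldots,x_1)$ (equivalently generated by the analogous fillings with rows weakly increasing), where $\mathrm{rev}(a)$ is $a$ reversed. *)

(* Defs.v *)
From HB Require Import structures.
From mathcomp Require Import all_boot all_order all_algebra.
From mathcomp Require Import mpoly.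

Set Implicit Arguments.
Unset Strict Implicit.
Unset Printing Implicit Defensive.

Import GRing.Theory.

Local Open Scope ring_scope.

(* A weak composition of length n is a tuple a : n.-tuple nat.  Rows, entries
   and variables are all indexed from 0 by 'I_n, so the entry k : 'I_n stands
   for the positive integer k + 1, and contributes the variable x_(k+1).  *)

(* Boxes (row, column) of the left-justified diagram of a; for such a box u,
   tag u is the row and tagged u the column.  *)
Notation diagram a := {i & 'I_(tnth a i)}.

(* Entries may be taken in 'I_n: in the fillings below, row i starts with i and
   weakly decreases, so no entry exceeds n.  *)
Definition particle_filling n (a : n.-tuple nat)
    (f : {ffun diagram a -> 'I_n}) : bool :=
  [&& [forall u : diagram a, forall v : diagram a,
         (tag u == tag v) && (tagged u <= tagged v)%N ==> (f v <= f u)%N],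
      [forall u : diagram a, (tagged u == 0%N :> nat) ==> (f u == tag u)]
    & [forall u : diagram a, forall v : diagram a,
         (tag u < tag v)%N ==> (f u < f v)%N]].

Definition fund_particle n (a : n.-tuple nat) : {mpoly int[n]} :=
  \sum_(f : {ffun diagram a -> 'I_n} | particle_filling f)
    \prod_(u : diagram a) 'X_(f u).

(* L_(rev a) (x_n, ..., x_1). *)
Definition young_fund_particle n (a : n.-tuple nat) : {mpoly int[n]} :=
  fund_particle [tuple of rev a] \mPo [tuple 'X_(rev_ord i) | i < n].

Definition zero_adjacent_to_ge2 n (a : n.-tuple nat) : Prop :=
  exists i j : 'I_n,
    [/\ (j = i.+1 :> nat) \/ (i = j.+1 :> nat),
        tnth a i = 0%N & (2 <= tnth a j)%N].

(* Main.v *)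
Require Import Defs.
From mathcomp Require Import all_boot all_order all_algebra.
From mathcomp Require Import mpoly.
From mathcomp Require Import zify.

Set Implicit Arguments.
Unset Strict Implicit.
Unset Printing Implicit Defensive.

Import GRing.Theory Num.Theory.

Local Open Scope ring_scope.

(** Strictness between rows lets an entry of row i leave the value i only when
    row i has another box and the neighbouring row (i - 1 for fundamental
    particles, i + 1 for Young ones) is empty.  So when no zero is adjacent to a
    part of size at least 2, both particles of a are the single monomial x^a.
    Conversely, if the particle of b is the Young particle of c, comparing the
    supports of the monomials x^b and x^c gives b = c.  Entries only move left in
    one family of fillings and only right in the other, so the weighted degree
    shows that no entry moves in any filling; a zero adjacent to a part of size
    at least 2 would allow one to move. *)

Section Fillings.
Variable n : nat.
Implicit Types (a : n.-tuple nat) (i j : 'I_n) (m : 'X_{1..n}).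

(** * Contents of fillings as exponent vectors *)

Definition content (F : finType) (f : F -> 'I_n) : 'X_{1..n} :=
  (\sum_u U_(f u))%MM.

Lemma contentE (F : finType) (f : F -> 'I_n) i :
  content f i = (\sum_u (f u == i))%N.
Proof. by rewrite /content mnm_sumE; apply: eq_bigr => u _; rewrite mnm1E. Qed.

Lemma content_gt0 (F : finType) (f : F -> 'I_n) i :
  reflect (exists u, f u = i) (0 < content f i)%N.
Proof.
rewrite lt0n contentE sum_nat_eq0; apply: (iffP forallPn) => -[u].
  by rewrite /= eqb0 negbK => /eqP; exists u.
by move=> fu; exists u; rewrite /= eqb0 negbK fu.
Qed.

(** The weight grows with each entry, so it detects any one-sided move of entries. *)
Lemma mnmwgt_content (F : finType) (f : F -> 'I_n) :
  mnmwgt (content f) = (\sum_u (f u).+1)%N.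
Proof.
rewrite /content (big_morph _ (@mnmwgtD n) (@mnmwgt0 n)).
by apply: eq_bigr => u _; rewrite mnmwgt1.
Qed.

Lemma prod_mpolyX_content (F : finType) (f : F -> 'I_n) :
  \prod_u 'X_(f u) = 'X_[content f] :> {mpoly int[n]}.
Proof. by rewrite mprodXE. Qed.

Lemma content_tag a : content (fun u : diagram a => tag u) = [multinom a].
Proof.
apply/mnmP => i; rewrite contentE multinomE.
rewrite -(@sig_big_dep _ _ _ _ _ xpredT (fun _ _ => true)
                      (fun j (_ : 'I_(tnth a j)) => (j == i) : nat)) /=.
rewrite (bigD1 i) //= [X in (_ + X)%N]big1 => [|j /negPf ne_ji].
  by rewrite eqxx sum1_card card_ord addn0.
by rewrite ne_ji big1.
Qed.

Lemma tnth_rev a i : tnth [tuple of rev a] i = tnth a (rev_ord i).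
Proof.
by rewrite !(tnth_nth 0%N) /= nth_rev size_tuple.
Qed.

Lemma content_rev_tag a :
  content (fun u : diagram [tuple of rev a] => rev_ord (tag u)) = [multinom a].
Proof.
apply/mnmP => i; rewrite contentE multinomE.
transitivity ([multinom [tuple of rev a]] (rev_ord i)).
  rewrite -content_tag contentE; apply: eq_bigr => u _.
  by rewrite -(inj_eq rev_ord_inj) rev_ordK.
by rewrite multinomE tnth_rev rev_ordK.
Qed.

Lemma fund_particleE a : fund_particle a =
  \sum_(f : {ffun diagram a -> 'I_n} | particle_filling f) 'X_[content f].
Proof. by apply: eq_bigr => f _; rewrite prod_mpolyX_content. Qed.

Lemma young_fund_particleE a : young_fund_particle a =
  \sum_(f : {ffun diagram [tuple of rev a] -> 'I_n} | particle_filling f)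
    'X_[content (fun u => rev_ord (f u))].
Proof.
rewrite /young_fund_particle /fund_particle raddf_sum /=.
apply: eq_bigr => f _; rewrite rmorph_prod /= -prod_mpolyX_content.
by apply: eq_bigr => u _; rewrite comp_mpolyXU -tnth_nth tnth_mktuple.
Qed.

(** The coefficient counts the [f] with [g f = m], so nothing cancels over the integers. *)
Lemma mcoeff_sum_mpolyX_neq0 (K : finType) (P : pred K) (g : K -> 'X_{1..n}) m :
  reflect (exists2 f, P f & g f = m)
          ((\sum_(f | P f) 'X_[g f] : {mpoly int[n]})@_m != 0).
Proof.
rewrite raddf_sum /=.
under eq_bigr => f _ do rewrite mcoeffX.
rewrite -natr_sum pnatr_eq0 sum_nat_eq0.
apply: (iffP forallPn) => -[f].
  by rewrite negb_imply eqb0 negbK => /andP[Pf /eqP]; exists f.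
by move=> Pf gf; exists f; rewrite negb_imply Pf gf eqxx.
Qed.

(** Only a zero on this side matters for fundamental particles: their entries can only decrease,
    from [i] into the empty row [j]. *)
Definition zero_before_ge2 a i j :=
  [/\ i = j.+1 :> nat, tnth a j = 0%N & (2 <= tnth a i)%N].

(** * When entries can leave the value of their row *)

Lemma particle_fillingP a (f : {ffun diagram a -> 'I_n}) :
  reflect [/\ forall u v : diagram a, tag u = tag v ->
                (tagged u <= tagged v)%N -> (f v <= f u)%N,
              forall u : diagram a, tagged u = 0%N :> nat -> f u = tag u
            & forall u v : diagram a, (tag u < tag v)%N -> (f u < f v)%N]
          (particle_filling f).
Proof.
apply: (iffP and3P) => -[row first cols]; split.
- move=> u v /eqP Euv le_uv; move/forallP/(_ u)/forallP/(_ v)/implyP: row.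
  by apply; rewrite Euv.
- by move=> u /eqP u0; move/forallP/(_ u)/implyP/(_ u0)/eqP: first.
- by move=> u v; move/forallP/(_ u)/forallP/(_ v)/implyP: cols; apply.
- apply/forallP => u; apply/forallP => v; apply/implyP => /andP[/eqP].
  exact: row.
- by apply/forallP => u; apply/implyP => /eqP/first ->.
- by apply/forallP => u; apply/forallP => v; apply/implyP; apply: cols.
Qed.

Lemma particle_filling_le_tag a (f : {ffun diagram a -> 'I_n}) :
  particle_filling f -> forall u, (f u <= tag u)%N.
Proof.
case/particle_fillingP => row first _ u.
have a_gt0 : (0 < tnth a (tag u))%N by case: (tagged u) => k; apply: leq_trans.
pose u0 : diagram a := Tagged (fun i => 'I_(tnth a i)) (Ordinal a_gt0).
by rewrite (leq_trans (row u0 u _ _)) // first.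
Qed.

Lemma particle_filling_tag a :
  particle_filling [ffun u : diagram a => tag u].
Proof.
apply/particle_fillingP; split=> [u v E _|u _|u v]; rewrite !ffunE //.
by rewrite E.
Qed.

(* An entry f u < tag u in a nonempty row f u would violate strictness, since
   that row starts with f u. *)
Lemma particle_filling_eq_tag a (f : {ffun diagram a -> 'I_n}) :
  particle_filling f -> (forall u, 0 < tnth a (f u))%N ->
  forall u, f u = tag u.
Proof.
move=> filf a_gt0 u; apply/val_inj/eqP; rewrite eqn_leq.
rewrite particle_filling_le_tag //= leqNgt; apply/negP => lt_fu.
case/particle_fillingP: filf => _ first strict.
pose v : diagram a := Tagged (fun i => 'I_(tnth a i)) (Ordinal (a_gt0 u)).
by have := strict v u lt_fu; rewrite (first v) //= ltnn.
Qed.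

(** A moved entry is not first in its row, so that row has at least two boxes and the previous row
    is nonempty. The latter starts with [tag u - 1], and strictness pushes [f u] back up to
    [tag u]. *)
Lemma particle_filling_no_zero_before a (f : {ffun diagram a -> 'I_n}) :
  (forall i j, ~ zero_before_ge2 a i j) -> particle_filling f ->
  forall u, f u = tag u.
Proof.
move=> no_zero filf u; apply/val_inj/eqP; rewrite eqn_leq.
rewrite particle_filling_le_tag //= leqNgt; apply/negP => lt_fu.
case/particle_fillingP: (filf) => _ first strict.
have a_ge2 : (2 <= tnth a (tag u))%N.
  have [u0|u_gt0] := posnP (tagged u); first by rewrite first ?ltnn in lt_fu.
  exact: leq_ltn_trans u_gt0 (ltn_ord _).
have lt_j : ((tag u).-1 < n)%N by apply: leq_ltn_trans (leq_pred _) (ltn_ord _).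
(* [lt_fu] makes [tag u] positive, so the truncated predecessor is the true one. *)
have Eu : tag u = (Ordinal lt_j).+1 :> nat by rewrite /= prednK //; lia.
have [a0|a_gt0] := posnP (tnth a (Ordinal lt_j)).
  by case: (no_zero (tag u) (Ordinal lt_j)).
pose v : diagram a := Tagged (fun i => 'I_(tnth a i)) (Ordinal a_gt0).
have lt_vu : (tag v < tag u)%N by rewrite Eu.
by have := strict v u lt_vu; rewrite (first v) //= ltnNge; lia.
Qed.

Lemma exists_particle_filling_lt_tag a i j : zero_before_ge2 a i j ->
  exists2 f : {ffun diagram a -> 'I_n}, particle_filling f &
    exists u, (f u < tag u)%N.
Proof.
case=> Eij aj0 ai2.
(* All boxes of row [i] but the first move to [j]; as row [j] is empty, earlier rows still have
   entries below [j]. *)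
pose f := [ffun u : diagram a =>
  if (tag u == i) && (0 < tagged u)%N then j else tag u].
exists f; last first.
  exists (Tagged (fun i => 'I_(tnth a i)) (Ordinal ai2)).
  by rewrite ffunE /= eqxx Eij.
have ne_j (u : diagram a) : (tag u != j :> nat).
  case: u => k [c lt_c] /=; apply/eqP => /val_inj Ek.
  by rewrite Ek aj0 in lt_c.
apply/particle_fillingP; split=> [u v E le_uv|u u0|u v lt_uv]; rewrite !ffunE.
- have -> : (tag u == i) = (tag v == i) by rewrite E.
  case: eqP => [Ei|_] /=; last by rewrite E.
  case: (posnP (tagged u)) => [_|u_gt0]; last by rewrite (leq_trans u_gt0).
  by rewrite E; case: ifP => // _; rewrite Ei Eij.
- by rewrite u0 andbF.
- have := ne_j u; case: ifP => [/andP[/eqP Eu _]|_];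
    case: ifP => [/andP[/eqP Ev _]|_]; rewrite ?Eu ?Ev in lt_uv *; lia.
Qed.

(** Reversal turns a zero just after a large part into one just before it. *)
Lemma zero_adjacent_to_ge2P a :
  zero_adjacent_to_ge2 a <->
  (exists i j, zero_before_ge2 a i j) \/
  (exists i j, zero_before_ge2 [tuple of rev a] i j).
Proof.
have rev_adj i j : i = j.+1 :> nat -> rev_ord j = (rev_ord i).+1 :> nat.
  by have := ltn_ord i; rewrite /=; lia.
split=> [[i] [j] [[Eij|Eij] ai aj] | [[i] [j] [Eij aj ai] | [i] [j] [Eij aj ai]]].
- by left; exists j, i.
- right; exists (rev_ord j), (rev_ord i); split; rewrite ?tnth_rev ?rev_ordK //.
  exact: rev_adj.
- by exists j, i; split; auto.
- exists (rev_ord j), (rev_ord i); rewrite -!tnth_rev; split; auto.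
Qed.

(** * Monomials occurring in the two particles *)

Lemma fund_particle_coeff_neq0 a m :
  reflect (exists2 f : {ffun diagram a -> 'I_n},
             particle_filling f & content f = m)
          ((fund_particle a)@_m != 0).
Proof. by rewrite fund_particleE; apply: mcoeff_sum_mpolyX_neq0. Qed.

Lemma young_fund_particle_coeff_neq0 a m :
  reflect (exists2 f : {ffun diagram [tuple of rev a] -> 'I_n},
             particle_filling f & content (fun u => rev_ord (f u)) = m)
          ((young_fund_particle a)@_m != 0).
Proof. by rewrite young_fund_particleE; apply: mcoeff_sum_mpolyX_neq0. Qed.

Lemma eq_content (F : finType) (f g : F -> 'I_n) :
  f =1 g -> content f = content g.
Proof. by move=> fg; apply: eq_bigr => u _; rewrite fg. Qed.

Lemma fund_particle_no_zero_before a :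
  (forall i j, ~ zero_before_ge2 a i j) -> fund_particle a = 'X_[[multinom a]].
Proof.
move=> no_zero; rewrite fund_particleE (big_pred1 [ffun u => tag u]) => [|f].
  by congr 'X_[_]; rewrite -content_tag; apply: eq_content => u; rewrite ffunE.
apply/idP/eqP => [filf|->]; last exact: particle_filling_tag.
by apply/ffunP => u; rewrite ffunE (particle_filling_no_zero_before no_zero).
Qed.

Lemma young_fund_particle_no_zero_before a :
  (forall i j, ~ zero_before_ge2 [tuple of rev a] i j) ->
  young_fund_particle a = 'X_[[multinom a]].
Proof.
move=> no_zero; rewrite young_fund_particleE.
rewrite (big_pred1 [ffun u => tag u]) => [|f].
  congr 'X_[_]; rewrite -content_rev_tag.
  by apply: eq_content => u; rewrite ffunE.
apply/idP/eqP => [filf|->]; last exact: particle_filling_tag.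
by apply/ffunP => u; rewrite ffunE (particle_filling_no_zero_before no_zero).
Qed.

Lemma fund_particle_coeff_self a : (fund_particle a)@_[multinom a] != 0.
Proof.
apply/fund_particle_coeff_neq0; exists [ffun u => tag u].
  exact: particle_filling_tag.
by rewrite -content_tag; apply: eq_content => u; rewrite ffunE.
Qed.

Lemma young_fund_particle_coeff_self a :
  (young_fund_particle a)@_[multinom a] != 0.
Proof.
apply/young_fund_particle_coeff_neq0; exists [ffun u => tag u].
  exact: particle_filling_tag.
by rewrite -content_rev_tag; apply: eq_content => u; rewrite ffunE.
Qed.

Lemma fund_particle_coeff_gt0 a m i :
  (fund_particle a)@_m != 0 -> (0 < tnth a i)%N -> (0 < m i)%N.
Proof.
case/fund_particle_coeff_neq0 => f /particle_fillingP[_ first _] <- a_gt0.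
apply/content_gt0; exists (Tagged (fun i => 'I_(tnth a i)) (Ordinal a_gt0)).
by rewrite first.
Qed.

Lemma young_fund_particle_coeff_gt0 a m i :
  (young_fund_particle a)@_m != 0 -> (0 < tnth a i)%N -> (0 < m i)%N.
Proof.
case/young_fund_particle_coeff_neq0 => f /particle_fillingP[_ first _] <- a_gt0.
have a'_gt0 : (0 < tnth [tuple of rev a] (rev_ord i))%N.
  by rewrite tnth_rev rev_ordK.
apply/content_gt0.
exists (Tagged (fun i => 'I_(tnth [tuple of rev a] i)) (Ordinal a'_gt0)).
by rewrite first // rev_ordK.
Qed.

(* Each of x^b, x^c occurs in both polynomials, so b and c have the same support;
   and x^c is the only monomial of the fundamental particle of b having that
   support only if it is x^b. *)
Lemma fund_particle_eq_young_index b c :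
  fund_particle b = young_fund_particle c -> b = c :> n.-tuple nat.
Proof.
move=> eq_bc.
have b_in := fund_particle_coeff_self b; rewrite eq_bc in b_in.
have c_in := young_fund_particle_coeff_self c; rewrite -eq_bc in c_in.
case/fund_particle_coeff_neq0: c_in => f filf cont_f.
have tag_f : forall u, f u = tag u.
  apply: particle_filling_eq_tag => // u.
  apply: young_fund_particle_coeff_gt0 b_in _.
  by rewrite -multinomE -cont_f; apply/content_gt0; exists u.
by have := content_tag b; rewrite -(eq_content tag_f) cont_f => -[].
Qed.

(* Entries move weakly left in a filling of a, and weakly right in the reversed
   filling of rev a; if both have the same content, no entry moves. *)
Lemma particle_filling_rev_content_eq a (f : {ffun diagram a -> 'I_n})
    (g : {ffun diagram [tuple of rev a] -> 'I_n}) :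
  particle_filling f -> particle_filling g ->
  content f = content (fun u => rev_ord (g u)) ->
  (forall u, f u = tag u) /\ (forall u, g u = tag u).
Proof.
move=> filf filg /(congr1 (@mnmwgt n)); rewrite !mnmwgt_content => eq_fg.
have [le_f eq_f] : (\sum_u (f u).+1 <= \sum_(u : diagram a) (tag u).+1
    ?= iff [forall u, f u == tag u])%N.
  by apply: leqif_sum => u _; split; rewrite ?ltnS ?particle_filling_le_tag.
have [le_g eq_g] : (\sum_(u : diagram [tuple of rev a]) (rev_ord (tag u)).+1
    <= \sum_u (rev_ord (g u)).+1 ?= iff [forall u, g u == tag u])%N.
  apply: leqif_sum => u _; have := particle_filling_le_tag filg u => le_gu.
  split; first by rewrite ltnS leq_sub2l.
  by rewrite eqSS (inj_eq val_inj) (inj_eq rev_ord_inj) eq_sym.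
have eq_tag : (\sum_(u : diagram a) (tag u).+1 =
    \sum_(u : diagram [tuple of rev a]) (rev_ord (tag u)).+1)%N.
  by rewrite -!mnmwgt_content content_tag content_rev_tag.
(* The two bounds and the two equalities close a cycle, so both bounds are attained, which [eq_f]
   and [eq_g] turn into pointwise equality. *)
have E : (\sum_u (f u).+1 = \sum_(u : diagram a) (tag u).+1)%N.
  by apply/eqP; rewrite eqn_leq le_f eq_tag eq_fg.
move: eq_f eq_g; rewrite -eq_fg -eq_tag E !eqxx.
by move=> /esym/forallP f_tag /esym/forallP g_tag; split=> u; apply/eqP.
Qed.

End Fillings.

Theorem mainTheorem15 (n : nat) (p : {mpoly int[n]}) :
  ((exists b : n.-tuple nat, p = fund_particle b) /\
   (exists c : n.-tuple nat, p = young_fund_particle c))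
  <->
  (exists a : n.-tuple nat,
     ~ zero_adjacent_to_ge2 a /\ p = young_fund_particle a).
Proof.
split=> [[[b ->] [c eq_bc]] | [a [nadj ->]]]; last first.
  split; exists a => //.
  (* The same index [a] serves for both families, since both particles collapse to [x^a]. *)
  rewrite fund_particle_no_zero_before => [|i j z].
    rewrite young_fund_particle_no_zero_before // => i j z.
    by apply/nadj/zero_adjacent_to_ge2P; right; exists i, j.
  by apply/nadj/zero_adjacent_to_ge2P; left; exists i, j.
have Ebc := fund_particle_eq_young_index eq_bc; subst c.
exists b; split=> //; case/zero_adjacent_to_ge2P => -[i [j]].
  (* A zero before a large part: the monomial of a filling with a moved entry would also have to
     come from a Young filling. *)
  case/exists_particle_filling_lt_tag => f filf [u lt_fu].
  have : (fund_particle b)@_(content f) != 0.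
    by apply/fund_particle_coeff_neq0; exists f.
  rewrite eq_bc => /young_fund_particle_coeff_neq0[g filg /esym eq_fg].
  case: (particle_filling_rev_content_eq filf filg eq_fg) => f_tag _.
  by rewrite f_tag ltnn in lt_fu.
(* A zero after a large part: the moved entry now lies in the Young filling. *)
case/exists_particle_filling_lt_tag => g filg [u lt_gu].
have : (young_fund_particle b)@_(content (fun u => rev_ord (g u))) != 0.
  by apply/young_fund_particle_coeff_neq0; exists g.
rewrite -eq_bc => /fund_particle_coeff_neq0[f filf eq_fg].
case: (particle_filling_rev_content_eq filf filg eq_fg) => _ g_tag.
by rewrite g_tag ltnn in lt_gu.
Qed.
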